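(* For every sequence $\mathbf{D}=(D_r)_{r\ge1}$ of positive real numbers there exists a sequence $\mathbf{C}=(C_r)_{r\ge1}$ of positive real numbers, depending only on $\mathbf{D}$, such that the following holds. Let $\{Y_\alpha,\alpha\in A\}$ be a family of random variables with finite moments defined on the same probability space. Let $\tilde L$ be a weighted graph with vertex set $A$ and let $\Psi$ be a super-multiplicative function on multisets of elements of $A$, with nonnegative values. Assume that, for any multiset $B$ of elements of $A$, one has $$\left|\kappa\Big(\prod_{\alpha\in B_1}Y_\alpha,\dots,\prod_{\alpha\in B_\ell}Y_\alpha\Big)\right|\le D_{|B|}\,\Psi(B)\,\mathcal{M}(\tilde L[B]),$$ where $B_1,\dots,B_\ell$ are the vertex sets of the connected components of the graph $\tilde L\langle1\rangle[B]$, that is, the graph induced on $B$ by the edges of weight $1$ of $\tilde L$. Then $\tilde L$ is a $(\Psi,\mathbf{C})$ weighted dependency graph for the family $\{Y_\alpha,\alpha\in A\}$.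
   Context: All multisets are finite and nonempty; $|B|$ is the number of elements of $B$ counted with multiplicity, $\uplus$ is disjoint union of multisets (multiplicities add), and products over a multiset are taken with multiplicity. A function $\Psi$ on multisets is super-multiplicative if $\Psi(B_1\uplus B_2)\ge\Psi(B_1)\Psi(B_2)$ for all multisets $B_1,B_2$. The joint cumulant of random variables $X_1,\dots,X_r$ with finite moments is $\kappa(X_1,\dots,X_r)=\sum_{\pi}(-1)^{\#(\pi)-1}(\#(\pi)-1)!\prod_{C\in\pi}\mathbb{E}\big(\prod_{i\in C}X_i\big)$, the sum being over set partitions $\pi$ of $\{1,\dots,r\}$; it is symmetric, so $\kappa(Y_\alpha;\alpha\in B)$ makes sense for a multiset $B$. A weighted graph $\tilde L$ is a finite simple graph with a weight in $[0,1]$ on each edge. For a multiset $B$ of vertices, the induced weighted graph $\tilde L[B]$ has one vertex for each element of $B$ counted with multiplicity; two vertices are joined if the corresponding vertices of $\tilde L$ are equal (then the edge has weight $1$) or joined by an edge in $\tilde L$ (then the edge has the weight of that edge). $\tilde L\langle1\rangle$ is the subgraph of $\tilde L$ formed by the edges of weight $1$, and $\tilde L\langle1\rangle[B]$ is its induced graph on $B$ (so copies of a same vertex are joined). For a weighted graph $K$, $\mathcal{M}(K)$ is the maximum over spanning trees of $K$ of the product of the edge weights of the tree ($1$ if $K$ has one vertex, $0$ by convention if $K$ is disconnected). $\tilde L$ is a $(\Psi,\mathbf{C})$ weighted dependency graph for $\{Y_\alpha,\alpha\in A\}$ if, for any $r\ge1$ and any multiset $B=\{\alpha_1,\dots,\alpha_r\}$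 of elements of $A$, $|\kappa(Y_\alpha;\alpha\in B)|\le C_r\,\Psi(B)\,\mathcal{M}(\tilde L[B])$. *)

(* Defs.v *)
From HB Require Import structures.
From mathcomp Require Import all_boot all_order all_algebra finmap multiset.
From mathcomp Require Import all_classical all_reals all_analysis.

Set Implicit Arguments.
Unset Strict Implicit.
Unset Printing Implicit Defensive.
Import Order.TTheory GRing.Theory Num.Theory.
Local Open Scope ring_scope.
Local Open Scope mset_scope.

Section Cumulants.
Context (R : realType) (d : measure_display) (T : measurableType d).
Variable P : probability T R.

Definition finite_moments (X : T -> R) : Prop :=
  forall k : nat, P.-integrable setT (fun w => (X w ^+ k)%:E).

(* The joint cumulant of the subfamily (X i ; i \in S), for S finite. *)
Definition cumulant (I : finType) (S : {set I}) (X : I -> T -> R) : R :=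
  \sum_(pi : {set {set I}} | finset.partition pi S)
    (-1) ^+ (#|pi|.-1) * (#|pi|.-1)`!%:R *
    \prod_(C in pi) fine 'E_P[fun w => \prod_(i in C) X i w].

End Cumulants.

(* Edges are the two-element vertex sets belonging to [edges]; [weight] is only
   meaningful on those. *)
Record weighted_graph (R : realType) (V : finType) := WeightedGraph {
  edges : {set {set V}};
  weight : {set V} -> R;
  card_edge : forall e, e \in edges -> #|e| = 2%N;
  weight_itv : forall e, e \in edges -> 0 <= weight e <= 1 }.

Section Graphs.
Context (V : finType).

Definition adj (E : {set {set V}}) : rel V := [rel x y | [set x; y]%SET \in E].

Definition connected_edges (E : {set {set V}}) : bool :=
  [forall x, forall y, connect (adj E) x y].

Definition acyclic_edges (E : {set {set V}}) : bool :=
  `[< forall c : seq V, (2 < size c)%N -> uniq c -> ~~ cycle (adj E) c >].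

Definition components (E : {set {set V}}) : {set {set V}} :=
  equivalence_partition (connect (adj E)) [set: V]%SET.

Definition spanning_trees (E : {set {set V}}) : {set {set {set V}}} :=
  [set F : {set {set V}} |
    [&& F \subset E, connected_edges F & acyclic_edges F]]%SET.

(* Weights are nonnegative, so the default value 0 is only reached when it is
   the maximum or when there is no spanning tree. *)
Definition max_tree_weight (R : realType) (K : weighted_graph R V) : R :=
  \big[Num.max/0]_(F in spanning_trees (edges K)) \prod_(e in F) weight K e.

End Graphs.

Section Induced.
Context (R : realType) (A : finType).
Implicit Types (L : weighted_graph R A) (B : {mset A}).

Section WeightOne.
Variable L : weighted_graph R A.

Definition edges1 : {set {set A}} := [set e in edges L | weight L e == 1]%SET.

Lemma card_edge1 e : e \in edges1 -> #|e| = 2%N.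
Proof. by rewrite inE => /andP[/card_edge]. Qed.

Lemma weight_itv1 e : e \in edges1 -> 0 <= weight L e <= 1.
Proof. by rewrite inE => /andP[/weight_itv]. Qed.

Definition weight1_subgraph : weighted_graph R A :=
  WeightedGraph card_edge1 weight_itv1.

End WeightOne.

(* The elements of B counted with multiplicity: the copy number i < B a of a is
   the pair (a, i), and [tag] recovers a. *)
Definition copies B : finType := {a : A & 'I_(B a)}.

Section InducedGraph.
Variables (L : weighted_graph R A) (B : {mset A}).

(* [tag @: e] is a singleton when the two ends of e are copies of one vertex. *)
Definition induced_edges : {set {set copies B}} :=
  [set e : {set copies B} | (#|e| == 2%N) &&
    ((#|tag @: e| == 1%N) || (tag @: e \in edges L))]%SET.

Definition induced_weight (e : {set copies B}) : R :=
  if #|tag @: e| == 1%N then 1 else weight L (tag @: e).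

Lemma induced_card_edge e : e \in induced_edges -> #|e| = 2%N.
Proof. by rewrite inE => /andP[/eqP]. Qed.

Lemma induced_weight_itv e : e \in induced_edges -> 0 <= induced_weight e <= 1.
Proof.
rewrite inE /induced_weight => /andP[_]; case: ifP => [_ _|_ /=].
  by rewrite ler01 lexx.
exact: weight_itv.
Qed.

Definition induced_graph : weighted_graph R (copies B) :=
  WeightedGraph induced_card_edge induced_weight_itv.

End InducedGraph.

(* Multisets are meant to be nonempty: nothing is asked of [Psi mset0]. *)
Definition super_multiplicative (Psi : {mset A} -> R) : Prop :=
  forall B1 B2, B1 != mset0 -> B2 != mset0 ->
    Psi B1 * Psi B2 <= Psi (B1 `+` B2).

Definition weighted_dependency_graph d (T : measurableType d)
    (P : probability T R) (Y : A -> T -> R) (L : weighted_graph R A)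
    (Psi : {mset A} -> R) (C : nat -> R) : Prop :=
  forall B, B != mset0 ->
    `|cumulant P [set: copies B]%SET (fun v => Y (tag v))|
      <= C (size B) * Psi B * max_tree_weight (induced_graph L B).

End Induced.

(* Main.v *)
Require Import Defs.
From HB Require Import structures.
From mathcomp Require Import all_boot all_order all_algebra finmap multiset.
From mathcomp Require Import all_classical all_reals all_analysis.
From mathcomp Require Import fintype finset.

Set Implicit Arguments.
Unset Strict Implicit.
Unset Printing Implicit Defensive.
Import Order.TTheory GRing.Theory Num.Theory.
Local Open Scope ring_scope.
Local Open Scope mset_scope.

(** Write V for the set of copies of the elements of B, and tau for the set of
connected components of the weight-one graph on V.  The formula of Leonov and
Shiryaev expands the cumulant of products
   kappa (prod_(v in b) Y_v ; b in tau)
as the sum, over the partitions pi of V whose join with tau is the one-block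
partition, of the products of the cumulants kappa (Y_v ; v in C), C in pi
([leonov_shiryaev]).  The term pi = {V} is the cumulant to be bounded, the left
side is bounded by hypothesis, and every other term only contains cumulants of
smaller multisets, so that strong induction on |B| applies as soon as the
bounds of the blocks multiply to the bound of B.

For Psi this is super-multiplicativity ([super_multiplicative_partition]).  For
the tree weights M ([prod_max_tree_weight_le]), take a spanning tree of maximal
weight in each block of pi and add all the edges of weight one: since the join
of pi and tau is trivial the resulting graph is connected, its weight is the
product of the weights of the trees, and passing to one of its spanning trees
can only increase the weight because the weights are at most 1.  The constants
then satisfy a recursion in |B| alone ([cumulant_bound]), because both the
number of partitions of V and the number of blocks of each are controlled by
|B|.

The Leonov-Shiryaev formula only involves the joint moments
m C = E (prod_(v in C) Y_v), and holds for every set function m with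
m set0 = 1.  The cumulants kappa of such an m are characterized by the recursion
   m S = sum of kappa D * m (S \ D) over the D inside S that contain x,
for one fixed point x of S ([cumulant_of_rec]).  Applied to the family tau and
to the function rho |-> m (cover rho), it characterizes the left side of the
formula, and the right side satisfies it too ([partition_sum_components]). *)

(** * Set partitions *)

Section Partitions.
Variable V : finType.
Implicit Types (S U C D : {set V}) (pi : {set {set V}}).

Lemma trivIset_eq pi C1 C2 x : trivIset pi -> C1 \in pi -> C2 \in pi ->
  x \in C1 -> x \in C2 -> C1 = C2.
Proof.
move=> tpi C1pi C2pi xC1 xC2.
by rewrite -(def_pblock tpi C1pi xC1) (def_pblock tpi C2pi xC2).
Qed.

Lemma partition_neq0_card pi S : S != set0 -> partition pi S -> (0 < #|pi|)%N.
Proof.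
move=> S0 pS; rewrite lt0n; apply: contra S0 => /eqP/cards0_eq pi0.
by rewrite -(cover_partition pS) pi0 /cover big_set0.
Qed.

Lemma partition_card1 pi S : partition pi S -> #|pi| = 1%N -> pi = [set S]%SET.
Proof.
by move=> pS /eqP/cards1P[D piD]; have := cover_partition pS; rewrite piD cover1 => ->.
Qed.

Lemma partition_set1 S : S != set0 -> partition [set S]%SET S.
Proof.
by move=> S0; rewrite /partition cover1 eqxx trivIset1 inE eq_sym.
Qed.

Lemma mem_block_pblock pi S C x : partition pi S -> x \in S -> C \in pi ->
  (x \in C) = (C == pblock pi x).
Proof.
move=> pS xS Cpi; apply/idP/eqP => [xC|->].
  by rewrite (def_pblock (partition_trivIset pS) Cpi xC).
by rewrite mem_pblock (cover_partition pS).
Qed.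

Lemma card_partition_le pi S : partition pi S -> (#|pi| <= #|S|)%N.
Proof.
move=> pS; rewrite (card_partition pS) -sum1_card; apply: leq_sum => C Cpi.
by rewrite card_gt0 (partition_neq0 pS).
Qed.

Lemma card_block_lt pi S C : partition pi S -> pi != [set S]%SET -> C \in pi ->
  (#|C| < #|S|)%N.
Proof.
move=> pS piS Cpi; apply: proper_card; rewrite properEneq (partitionS pS Cpi) andbT.
apply: contraNneq piS => CS; rewrite eqEsubset sub1set -CS Cpi andbT.
apply/subsetP => C' C'pi; have /set0Pn[x xC'] := partition_neq0 pS C'pi.
have xC : x \in C by rewrite CS (subsetP (partitionS pS C'pi)).
by rewrite inE (trivIset_eq (partition_trivIset pS) C'pi Cpi xC' xC).
Qed.

(** Removing the block D is a bijection from the partitions of S that have D as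
a block to the partitions of the complement of D in S. *)
Lemma sum_partition_block (R : nmodType) (Q : pred {set V}) S
    (G : {set V} -> {set {set V}} -> R) :
  \sum_(pi | partition pi S) \sum_(D in pi | Q D) G D (pi :\ D)%SET =
  \sum_(D : {set V} | [&& D \subset S, D != set0 & Q D])
    \sum_(pi | partition pi (S :\: D)%SET) G D pi.
Proof.
rewrite (exchange_big_dep (fun D => [&& D \subset S, D != set0 & Q D])) /=;
  last first.
  move=> pi D pS /andP[Dpi QD]; apply/and3P; split=> //.
    exact: partitionS pS Dpi.
  exact: partition_neq0 pS Dpi.
apply: eq_bigr => D /and3P[DS D0 QD].
rewrite (reindex_onto (fun pi => D |: pi)%SET (fun pi => pi :\ D)%SET) /=; last first.
  by move=> pi /and3P[_ Dpi _]; rewrite setD1K.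
apply: eq_big => [pi|pi /andP[_ /eqP->]] //.
rewrite setU11 QD andbT andbT.
apply/andP/idP => [[pS /eqP <-]|pS].
  by apply: partitionD1 pS _; rewrite setU11.
have Dpi : D \notin pi.
  apply/negP => Dpi; have := partitionS pS Dpi => /subsetP sD.
  by case/set0Pn: D0 => x xD; have := sD x xD; rewrite inE xD.
split; last by rewrite setU1K.
have dj : [disjoint D & (S :\: D)%SET].
  by rewrite -setI_eq0; apply/eqP/setP => x; rewrite !inE; case: (x \in D).
have := partitionU1 pS D0 dj.
suff -> : (D :|: S :\: D)%SET = S by [].
apply/setP => x; rewrite !inE; case: (boolP (x \in D)) => //= xD.
by rewrite (subsetP DS).
Qed.

End Partitions.

(** * Moments and cumulants of a set function *)

Section MomentsCumulants.
Variable R : comNzRingType.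

(** The cumulant formula with an arbitrary set function m in the place of the
joint moments: products of random variables over the blocks of a family then
only change m, into the composition of m with [cover]. *)
Definition cumulant_of (V : finType) (m : {set V} -> R) (S : {set V}) : R :=
  \sum_(pi : {set {set V}} | partition pi S)
    (-1) ^+ (#|pi|.-1) * (#|pi|.-1)`!%:R * \prod_(C in pi) m C.

Definition partition_sum (V : finType) (k : {set V} -> R) (S : {set V}) : R :=
  \sum_(pi : {set {set V}} | partition pi S) \prod_(C in pi) k C.

Section Recursions.
Variables (V : finType).
Implicit Types (m k : {set V} -> R) (S : {set V}).

Lemma partition_sum0 k : partition_sum k set0 = 1.
Proof.
rewrite /partition_sum (big_pred1 set0) ?big_set0 // => pi.
exact: partition_set0.
Qed.

(** Group the partitions according to the block D that contains x. *)
Lemma partition_sum_rec k S x : x \in S ->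
  partition_sum k S =
  \sum_(D : {set V} | (D \subset S) && (x \in D)) k D * partition_sum k (S :\: D)%SET.
Proof.
move=> xS; rewrite /partition_sum.
transitivity (\sum_(pi : {set {set V}} | partition pi S)
   \sum_(D in pi | x \in D) k D * \prod_(C in (pi :\ D)%SET) k C).
  apply: eq_bigr => pi pS.
  have pbx : pblock pi x \in pi by rewrite pblock_mem // (cover_partition pS).
  rewrite [RHS](big_pred1 (pblock pi x)) => [|D]; first by rewrite -big_setD1.
  case: (boolP (D \in pi)) => Dpi /=; first exact: mem_block_pblock pS xS Dpi.
  by apply/esym; apply: contraNF Dpi => /eqP->.
rewrite (sum_partition_block (fun D => x \in D) S
  (fun D pi => k D * \prod_(C in pi) k C)).
apply: eq_big => [D|D _]; last by rewrite mulr_sumr.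
case: (D \subset S) => //=; apply/andP/idP => [[]|xD] //; split=> //.
by apply/set0Pn; exists x.
Qed.

(** Write the coefficient of a partition with n blocks as c n.  A term
[cumulant_of m D * m (S :\: D)] with D a proper subset of S is a sum over the
partitions of S with the marked block S :\: D, which does not contain x.  A
partition of S into n blocks has n - 1 such blocks, hence occurs in total with
the coefficient c n + (n - 1) * c (n - 1), which vanishes unless n = 1. *)
Lemma cumulant_of_rec m S x : m set0 = 1 -> x \in S ->
  m S = \sum_(D : {set V} | (D \subset S) && (x \in D))
          cumulant_of m D * m (S :\: D)%SET.
Proof.
move=> m0 xS; have S0 : S != set0 by apply/set0Pn; exists x.
pose c n : R := (-1) ^+ n.-1 * (n.-1)`!%:R.
have Erest : \sum_(D : {set V} | [&& D \subset S, x \in D & D != S])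
    cumulant_of m D * m (S :\: D)%SET =
  \sum_(pi | partition pi S) c #|pi|.-1 * (#|pi|.-1)%:R * \prod_(C in pi) m C.
  (* The marked block is the complement E of D. *)
  rewrite (reindex_onto (fun E => S :\: E)%SET (fun E => S :\: E)%SET) /=; last first.
    move=> D /and3P[DS _ _]; rewrite setDDr setDv set0U.
    exact/setIidPr.
  transitivity (\sum_(E : {set V} | [&& E \subset S, E != set0 & x \notin E])
     \sum_(pi | partition pi (S :\: E)%SET) m E * (c #|pi| * \prod_(C in pi) m C)).
    have inv E : ((S :\: (S :\: E) == E) = (E \subset S))%SET.
      rewrite setDDr setDv set0U.
      by apply/eqP/idP => [<-|/setIidPr//]; rewrite subsetIl.
    apply: eq_big => [E|E /andP[_ /eqP->]]; last by rewrite -mulr_sumr mulrC.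
    rewrite inv subsetDl inE xS andbT /= andbC.
    case: (boolP (E \subset S)) => //= ES; rewrite andbC; congr (_ && _); congr negb.
    apply/eqP/eqP => [|->]; last by rewrite setD0.
    move=> SE; apply/eqP; rewrite -subset0; apply/subsetP => y yE.
    by have := subsetP ES _ yE; rewrite -{1}SE inE yE.
  rewrite -(sum_partition_block (fun E => x \notin E) S
    (fun E pi => m E * (c #|pi| * \prod_(C in pi) m C))).
  apply: eq_bigr => pi pS.
  have pbx : pblock pi x \in pi by rewrite pblock_mem // (cover_partition pS).
  rewrite (eq_bigr (fun=> c #|pi|.-1 * \prod_(C in pi) m C)); last first.
    move=> E /andP[Epi _]; rewrite mulrCA -(big_setD1 E) //=.
    by rewrite (cardsD1 E pi) Epi.
  rewrite sumr_const -mulrnAl; congr (_ * _); rewrite mulr_natr; congr (_ *+ _).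
  rewrite (cardsD1 (pblock pi x) pi) pbx /=.
  apply: eq_card => D; rewrite !inE [LHS]unfold_in andbC.
  case: (boolP (D \in pi)) => Dpi; rewrite ?andbF ?andbT //; congr negb.
  exact: mem_block_pblock pS xS Dpi.
rewrite (bigD1 S) ?subxx //= setDv m0 mulr1.
under eq_bigl do rewrite -andbA.
rewrite Erest /cumulant_of -big_split /=.
(* The one-block partition, where c #|pi|.-1 is multiplied by 0. *)
rewrite (bigD1 [set S]%SET) ?partition_set1 //= big_set1 cards1 /= /c.
rewrite !(expr0, mul1r, mulr0, mul0r, addr0, fact0).
rewrite big1 ?addr0 // => pi /andP[pS piS].
have := partition_neq0_card S0 pS.
case: #|pi| (partition_card1 pS) => [//|[|n]] /= pi1 _.
  by rewrite pi1 // eqxx in piS.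
rewrite -mulrDl factS natrM exprS !mulN1r mulrA mulNr; set a := (-1) ^+ n.
by rewrite mulNr -mulrA [n.+1%:R * _]mulrC mulrA addNr mul0r.
Qed.

(** The two recursions [partition_sum_rec] and [cumulant_of_rec] agree. *)
Theorem moment_cumulant m S : m set0 = 1 -> partition_sum (cumulant_of m) S = m S.
Proof.
move=> m0; have [n] := ubnP #|S|; elim: n S => // n IH S Sn.
have [->|/set0Pn[x xS]] := eqVneq S set0; first by rewrite partition_sum0.
rewrite (partition_sum_rec _ xS) (cumulant_of_rec m0 xS).
apply: eq_bigr => D /andP[DS xD]; rewrite IH //.
apply: leq_trans (proper_card _) Sn; apply/properP; split; first exact: subsetDl.
by exists x; rewrite // inE xD.
Qed.

End Recursions.
End MomentsCumulants.


(** * The formula of Leonov and Shiryaev *)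

Section Saturated.
Variable V : finType.
Implicit Types (S U W C : {set V}) (pi tau rho : {set {set V}}).

(** U is a union of blocks of pi; [pi ::&: U] collects the blocks inside U. *)
Definition saturated pi U := cover (pi ::&: U) == U.

Lemma saturatedP pi U :
  reflect (forall x, x \in U -> exists C, [/\ C \in pi, x \in C & C \subset U])
    (saturated pi U).
Proof.
apply: (iffP eqP) => [satU x|sat].
  by rewrite -{1}satU => /bigcupP[C]; rewrite inE => /andP[Cpi CU] xC; exists C.
apply/setP => x; apply/bigcupP/idP => [[C]|/sat[C [Cpi xC CU]]].
  by rewrite inE => /andP[_ /subsetP]; apply.
by exists C => //; rewrite inE Cpi.
Qed.

Lemma saturatedI pi U W : trivIset pi -> saturated pi U -> saturated pi W ->
  saturated pi (U :&: W).
Proof.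
move=> tpi /saturatedP satU /saturatedP satW; apply/saturatedP => x /setIP[xU xW].
have [C [Cpi xC CU]] := satU x xU; have [C' [Cpi' xC' CW]] := satW x xW.
by exists C; rewrite subsetI CU Cpi xC (trivIset_eq tpi Cpi Cpi' xC xC').
Qed.

Lemma saturatedD pi U W : trivIset pi -> saturated pi U -> saturated pi W ->
  saturated pi (U :\: W).
Proof.
move=> tpi /saturatedP satU /saturatedP satW; apply/saturatedP => x /setDP[xU xW].
have [C [Cpi xC CU]] := satU x xU; exists C; split=> //.
rewrite subsetD CU disjoint_subset /=; apply/subsetP => y yC.
rewrite inE; apply/negP => yW.
have [C' [Cpi' yC' CW]] := satW y yW.
by case/negP: xW; rewrite (subsetP CW) // -(trivIset_eq tpi Cpi Cpi' yC yC').
Qed.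

Lemma saturated_cover pi : saturated pi (cover pi).
Proof.
by apply/saturatedP => x /bigcupP[C Cpi xC]; exists C; rewrite Cpi xC (bigcup_max C).
Qed.

Lemma restrict_restrict pi U W : W \subset U -> (pi ::&: U) ::&: W = pi ::&: W.
Proof.
move=> WU; apply/setP => C; rewrite !inE -andbA; case: (C \in pi) => //=.
by apply/andb_idl => CW; apply: subset_trans WU.
Qed.

Lemma partition_restrict pi S U : partition pi S -> saturated pi U ->
  partition (pi ::&: U) U.
Proof.
move=> pS satU; rewrite /partition (eqP satU) eqxx trivIsetI ?(partition_trivIset pS) //.
by rewrite inE (partition0 pS).
Qed.

Lemma restrictD pi S U : partition pi S -> saturated pi U ->
  pi ::&: (S :\: U) = pi :\: (pi ::&: U).
Proof.
move=> pS satU; apply/setP => C; rewrite !inE.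
case: (boolP (C \in pi)) => Cpi; rewrite ?andbF //=.
rewrite andbT subsetD (partitionS pS Cpi) /= disjoint_subset.
apply/subsetP/idP => [dCU|CU x xC]; last first.
  rewrite inE; apply: contra CU => xU.
  have [C' [C'pi xC' C'U]] := saturatedP _ _ satU x xU.
  by rewrite (trivIset_eq (partition_trivIset pS) Cpi C'pi xC xC').
have /set0Pn[x xC] := partition_neq0 pS Cpi.
by apply: contra (dCU x xC) => /subsetP; apply.
Qed.

Lemma restrict_union pi S U : partition pi S -> saturated pi U ->
  (pi ::&: U) :|: (pi ::&: (S :\: U)) = pi.
Proof.
move=> pS satU; rewrite (restrictD pS satU); apply/setP => C; rewrite !inE.
by case: (C \in pi) => //=; case: (C \subset U).
Qed.

Lemma restrict_id pi S U W : partition pi S -> S \subset U -> pi ::&: U = pi.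
Proof.
move=> pS SU; apply/setP => C; rewrite !inE; apply/andb_idr => Cpi.
by apply: subset_trans SU; apply: partitionS pS Cpi.
Qed.

Lemma restrict_disjoint pi S U : partition pi S -> [disjoint S & U] -> pi ::&: U = set0.
Proof.
move=> pS dSU; apply/setP => C; rewrite !inE; apply/negP => /andP[Cpi CU].
have /set0Pn[x xC] := partition_neq0 pS Cpi.
have := disjointFr dSU (subsetP (partitionS pS Cpi) _ xC).
by rewrite (subsetP CU).
Qed.

Lemma partition_union pi1 pi2 S U : U \subset S ->
  partition pi1 U -> partition pi2 (S :\: U) -> partition (pi1 :|: pi2) S.
Proof.
move=> US p1 p2; rewrite /partition !inE (partition0 p1) (partition0 p2) andbT.
have cU : cover (pi1 :|: pi2) = cover pi1 :|: cover pi2 by rewrite /cover bigcup_setU.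
rewrite cU (cover_partition p1) (cover_partition p2) trivIsetU.
- rewrite andbT; apply/eqP/setP => x; rewrite !inE.
  by case: (boolP (x \in U)) => //= xU; rewrite (subsetP US).
- exact: partition_trivIset p1.
- exact: partition_trivIset p2.
rewrite (cover_partition p1) (cover_partition p2).
by rewrite -setI_eq0; apply/eqP/setP => x; rewrite !inE; case: (x \in U).
Qed.

(** The partitions of S in which U is a union of blocks are the unions of a
partition of U and a partition of its complement in S. *)
Lemma sum_partition_split (R : nmodType) S U
    (G : {set {set V}} -> {set {set V}} -> R) : U \subset S ->
  \sum_(pi | partition pi S && saturated pi U) G (pi ::&: U) (pi ::&: (S :\: U)) =
  \sum_(pi1 | partition pi1 U) \sum_(pi2 | partition pi2 (S :\: U)) G pi1 pi2.
Proof.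
move=> US; rewrite pair_big_dep /=.
rewrite (reindex_onto (fun p => p.1 :|: p.2)
   (fun pi : {set {set V}} => (pi ::&: U, pi ::&: (S :\: U)))) /=; last first.
  by move=> pi /andP[pS satU]; rewrite (restrict_union pS).
apply: eq_big => [[pi1 pi2]|[pi1 pi2] /andP[_ /eqP[-> ->]]] //=.
apply/andP/andP => [[/andP[pS satU] /eqP[e1 e2]]|[p1 p2]].
  split; first by rewrite -e1; apply: partition_restrict pS satU.
  rewrite -e2; apply: (partition_restrict pS); apply: saturatedD => //.
    exact: partition_trivIset pS.
  by rewrite -(cover_partition pS); apply: saturated_cover.
have restrictU (W : {set V}) : (pi1 :|: pi2) ::&: W = (pi1 ::&: W) :|: (pi2 ::&: W).
  by apply/setP => C; rewrite !inE andb_orl.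
have d1 : [disjoint S :\: U & U].
  by rewrite disjoint_subset; apply/subsetP => x; rewrite !inE => /andP[].
have eU : (pi1 :|: pi2) ::&: U = pi1.
  by rewrite restrictU (restrict_id _ p1) // (restrict_disjoint p2) // setU0.
have eS : (pi1 :|: pi2) ::&: (S :\: U) = pi2.
  rewrite restrictU (restrict_id _ p2) // (restrict_disjoint p1) ?set0U //.
  by rewrite disjoint_sym.
split; last by rewrite eU eS.
rewrite (partition_union US) //= /saturated eU; exact/eqP/cover_partition.
Qed.

(** No proper nonempty subfamily of tau covers a union of blocks of pi.  When tau
and pi partition the same set, this says that their join is the partition into
one block. *)
Definition indecomposable tau pi :=
  [forall rho : {set {set V}},
    [&& rho \subset tau, rho != set0 & saturated pi (cover rho)] ==> (rho == tau)].

Lemma indecomposableP tau pi :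
  reflect (forall rho, rho \subset tau -> rho != set0 -> saturated pi (cover rho) ->
             rho = tau)
    (indecomposable tau pi).
Proof.
apply: (iffP forallP) => [ind rho s1 s2 s3|ind rho].
  by have := ind rho; rewrite s1 s2 s3 => /eqP.
by apply/implyP => /and3P[s1 s2 s3]; apply/eqP/ind.
Qed.

Lemma indecomposable_set1 tau S : partition tau S -> indecomposable tau [set S].
Proof.
move=> tS; apply/indecomposableP => rho /subsetP srho /set0Pn[b brho] sat.
have /set0Pn[x xb] := partition_neq0 tS (srho _ brho).
have xrho : x \in cover rho by apply/bigcupP; exists b.
have [C [/set1P-> _ /subsetP Srho]] := saturatedP _ _ sat x xrho.
apply/eqP; rewrite eqEsubset; apply/andP; split; apply/subsetP => // c ct.
have /set0Pn[y yc] := partition_neq0 tS ct.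
have /bigcupP[c' c'r yc'] := Srho y (subsetP (partitionS tS ct) _ yc).
by rewrite (trivIset_eq (partition_trivIset tS) ct (srho _ c'r) yc yc').
Qed.

Lemma coverI tau rho1 rho2 : trivIset tau -> rho1 \subset tau -> rho2 \subset tau ->
  cover (rho1 :&: rho2) = cover rho1 :&: cover rho2.
Proof.
move=> ttau s1 s2; apply/setP => x; apply/bigcupP/setIP => [[C /setIP[C1 C2] xC]|].
  by split; apply/bigcupP; exists C.
move=> [/bigcupP[C1 C1r xC1] /bigcupP[C2 C2r xC2]]; exists C1 => //.
by rewrite inE C1r (trivIset_eq ttau (subsetP s1 _ C1r) (subsetP s2 _ C2r) xC1 xC2).
Qed.

Lemma coverD tau rho : trivIset tau -> rho \subset tau ->
  cover (tau :\: rho) = cover tau :\: cover rho.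
Proof.
move=> ttau s1; apply/setP => x; apply/bigcupP/setDP => [[C /setDP[Ct Cr] xC]|].
  split; first by apply/bigcupP; exists C.
  apply/bigcupP => -[C' C'r xC']; case/negP: Cr.
  by rewrite (trivIset_eq ttau Ct (subsetP s1 _ C'r) xC xC').
move=> [/bigcupP[C Ct xC] nx]; exists C => //; rewrite inE Ct andbT.
by apply: contra nx => Cr; apply/bigcupP; exists C.
Qed.

Lemma coverS rho tau : rho \subset tau -> cover rho \subset cover tau.
Proof. by move=> /subsetP s; apply/bigcupsP => C /s Ct; apply: bigcup_max Ct _. Qed.

(** This is the block containing b in the join of tau and pi, seen as the set of
the members of tau inside it: the smallest saturated subfamily around b. *)
Lemma component_unique tau pi b :
  trivIset tau -> b \in tau -> partition pi (cover tau) ->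
  exists rho0, forall rho,
    [&& rho \subset tau, b \in rho, saturated pi (cover rho)
      & indecomposable rho (pi ::&: cover rho)] = (rho == rho0).
Proof.
move=> ttau btau pS; have tpi := partition_trivIset pS.
pose Q rho := [&& rho \subset tau, b \in rho & saturated pi (cover rho)].
have Qtau : Q tau.
  by rewrite /Q subxx btau -(cover_partition pS) saturated_cover.
have [rho0 /minsetP[/and3P[s0 b0 sat0] min0] _] := minset_exists Qtau.
have satI rho rho' : rho' \subset rho -> saturated (pi ::&: cover rho) (cover rho') ->
    saturated pi (cover rho').
  by move=> ss; rewrite /saturated restrict_restrict // coverS.
have ind0 : indecomposable rho0 (pi ::&: cover rho0).
  apply/indecomposableP => rho srho rho_n0 /(satI _ _ srho) satr.
  have [brho|brho] := boolP (b \in rho).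
    by apply: min0 => //; rewrite /Q (subset_trans srho s0) brho.
  have eD : rho0 :\: rho = rho0.
    apply: min0 (subsetDl _ _); rewrite /Q (subset_trans (subsetDl _ _) s0) inE brho b0.
    by rewrite (coverD (trivIsetS s0 ttau) srho) saturatedD.
  case/negP: rho_n0; apply/eqP/setP => C; rewrite in_set0; apply/negP => Cr.
  by have := subsetP srho _ Cr; rewrite -eD inE Cr.
exists rho0 => rho; apply/and4P/eqP => [|->]; last by split.
move=> [srho brho satr /indecomposableP ind].
have sat_I : saturated pi (cover (rho :&: rho0)).
  by rewrite (coverI ttau) // saturatedI.
have eqI rho' : rho' \subset tau -> saturated pi (cover rho') ->
    indecomposable rho' (pi ::&: cover rho') -> b \in rho' -> rho :&: rho0 \subset rho' ->
    rho :&: rho0 = rho'.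
  move=> s' sat' /indecomposableP ind' b' sub; apply: ind' => //.
    by apply/set0Pn; exists b; rewrite inE brho.
  by rewrite /saturated restrict_restrict // coverS.
rewrite -(eqI rho) ?subsetIl //; last exact/indecomposableP.
by rewrite (eqI rho0) ?subsetIr.
Qed.

End Saturated.

Section LeonovShiryaev.
Variables (R : comNzRingType) (V : finType).
Implicit Types (m k : {set V} -> R) (tau rho pi : {set {set V}}).

(** The right side of the Leonov-Shiryaev formula. *)
Definition indecomposable_sum k tau : R :=
  \sum_(pi | partition pi (cover tau) && indecomposable tau pi) \prod_(C in pi) k C.

(** Group the partitions pi according to the component rho of b in the join of
tau and pi: pi splits into an indecomposable partition of [cover rho] and an
arbitrary partition of the rest. *)
Lemma partition_sum_components k tau b : trivIset tau -> b \in tau ->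
  partition_sum k (cover tau) =
  \sum_(rho : {set {set V}} | (rho \subset tau) && (b \in rho))
    indecomposable_sum k rho * partition_sum k (cover (tau :\: rho)).
Proof.
move=> ttau btau.
pose part rho pi := saturated pi (cover rho) && indecomposable rho (pi ::&: cover rho).
transitivity (\sum_(pi | partition pi (cover tau))
   \sum_(rho : {set {set V}} | [&& rho \subset tau, b \in rho & part rho pi])
     \prod_(C in pi) k C).
  apply: eq_bigr => pi pS; have [rho0 e] := component_unique ttau btau pS.
  by rewrite (big_pred1 rho0).
rewrite (exchange_big_dep
  (fun rho : {set {set V}} => (rho \subset tau) && (b \in rho))) /=;
  last by move=> pi rho _ /and3P[-> ->].
apply: eq_bigr => rho /andP[srho brho].
pose g pi1 pi2 : R := if indecomposable rho pi1 then
  (\prod_(C in pi1) k C) * \prod_(C in pi2) k C else 0.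
transitivity (\sum_(pi | partition pi (cover tau) && saturated pi (cover rho))
   g (pi ::&: cover rho) (pi ::&: (cover tau :\: cover rho))).
  rewrite [RHS]big_mkcond /= [LHS]big_mkcond /=; apply: eq_bigr => pi _.
  rewrite srho brho /part /g /=; case: (boolP (partition pi _)) => //= pS.
  case: (boolP (saturated pi _)) => //= satr; case: ifP => //= _.
  rewrite (restrictD pS satr) [LHS](big_setID (pi ::&: cover rho)) /=.
  by rewrite (setIidPr _) // -setI_powerset subsetIl.
rewrite sum_partition_split ?coverS // /indecomposable_sum /partition_sum.
rewrite mulr_suml [RHS]big_mkcondr /=; apply: eq_bigr => pi1 _.
rewrite /g -(coverD ttau srho); case: ifP => _; first by rewrite mulr_sumr.
by rewrite big1.
Qed.

(** Both sides satisfy the recursion that expresses [m (cover tau)] by summing over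
the subfamilies of tau around a fixed member b. *)
Theorem leonov_shiryaev m tau : m set0 = 1 -> trivIset tau -> tau != set0 ->
  cumulant_of (fun rho : {set {set V}} => m (cover rho)) tau =
  indecomposable_sum (cumulant_of m) tau.
Proof.
move=> m0; have [n] := ubnP #|tau|; elim: n tau => // n IH tau taun ttau /set0Pn[b btau].
have mc0 : m (cover set0) = 1 by rewrite /cover big_set0.
have := partition_sum_components (cumulant_of m) ttau btau.
rewrite moment_cumulant // (cumulant_of_rec (m := fun rho => m (cover rho)) mc0 btau).
rewrite [X in X = _ -> _](bigD1 tau) ?subxx //=.
rewrite [X in _ = X -> _](bigD1 tau) ?subxx //=.
rewrite setDv !moment_cumulant // mc0 !mulr1.
set s1 := (X in _ + X); set s2 := (X in _ = _ + X); suff -> : s1 = s2 by move/addIr.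
apply: eq_bigr => rho /andP[/andP[srho brho] rtau].
rewrite moment_cumulant // IH //.
- apply: leq_trans (proper_card _) taun; rewrite properEneq rtau //.
- exact: trivIsetS ttau.
by apply/set0Pn; exists b.
Qed.

End LeonovShiryaev.


(** * Spanning trees *)

Section Connectivity.
Variable V : finType.
Implicit Types (E F : {set {set V}}) (x y u v : V).

Lemma adjE E x y : adj E x y = ([set x; y]%SET \in E).
Proof. by []. Qed.

Lemma adj_sym E : symmetric (adj E).
Proof. by move=> x y; rewrite /adj /= setUC. Qed.

Lemma connect_adj_sym E : connect_sym (adj E).
Proof. exact/sym_connect_sym/adj_sym. Qed.

Lemma connect_adjS E F : E \subset F -> subrel (connect (adj E)) (connect (adj F)).
Proof. by move=> /subsetP EF; apply: connect_sub => x y /EF ?; apply: connect1. Qed.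

Lemma components_partition E : partition (components E) [set: V]%SET.
Proof.
apply: equivalence_partitionP => x y z _ _ _; split=> [|xy]; first exact: connect0.
exact: same_connect (@connect_adj_sym E) _ _ xy z.
Qed.

Lemma mem_components E B : B \in components E ->
  {in B &, forall x y, connect (adj E) x y}.
Proof.
move=> /imsetP[z _ ->] x y; rewrite !inE /= => zx zy.
by apply: connect_trans zy; rewrite connect_adj_sym.
Qed.

Lemma connected_edgesP F :
  reflect (forall x y, connect (adj F) x y) (connected_edges F).
Proof.
by apply: (iffP forallP) => [h x y|h x]; [apply: (forallP (h x))|apply/forallP].
Qed.

Lemma connected_setD1_cycle F x y z c :
  connected_edges F -> uniq [:: x, y, z & c] -> cycle (adj F) [:: x, y, z & c] ->
  connected_edges (F :\ [set x; y]%SET).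
Proof.
move=> /connected_edgesP conn Uc; rewrite [cycle _ _]/= => /and3P[_ Fyz pathz].
set E := F :\ _.
(* The way round the rest of the cycle: every edge after the first one misses y. *)
have Exy : connect (adj E) y x.
  have /and3P[xn yn _] : [&& x \notin y :: z :: c, y \notin z :: c & uniq (z :: c)] := Uc.
  apply/connectP; exists (z :: rcons c x); last by rewrite /= last_rcons.
  rewrite /=; apply/andP; split.
    rewrite adjE in_setD1 -adjE Fyz andbT; apply/eqP => e.
    have : z \in [set x; y]%SET by rewrite -e set22.
    rewrite !inE => /orP[]/eqP ez; [move: xn|move: yn]; rewrite ez !inE eqxx ?orbT //.
  apply: (@sub_in_path _ (predC1 y) (adj F)) pathz => [u v uy vy Fuv|].
    rewrite adjE in_setD1 -adjE Fuv andbT; apply/eqP => e.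
    have : y \in [set u; v]%SET by rewrite e set22.
    by rewrite !inE !(eq_sym y) (negbTE uy) (negbTE vy).
  apply/allP => u; rewrite -rcons_cons mem_rcons inE => uc; apply/eqP => uy.
  move: uc; rewrite uy => /orP[/eqP yx|]; last exact/negP.
  by move: xn; rewrite yx !inE eqxx.
apply/connected_edgesP => u v; apply: connect_sub (conn u v) => {}u {}v Fuv.
have [uvxy|uvxy] := eqVneq [set u; v]%SET [set x; y]%SET; last first.
  by apply: connect1; rewrite adjE in_setD1 uvxy.
have : u \in [set x; y]%SET by rewrite -uvxy set21.
have : v \in [set x; y]%SET by rewrite -uvxy set22.
by rewrite !inE => /orP[]/eqP-> /orP[]/eqP-> //; rewrite ?connect0 // connect_adj_sym.
Qed.

(** A minimal connected edge set is acyclic: removing an edge of a cycle keeps it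
connected. *)
Lemma exists_spanning_tree F : connected_edges F ->
  exists2 F0 : {set {set V}}, F0 \subset F & connected_edges F0 && acyclic_edges F0.
Proof.
move=> connF; have [F0 /minsetP[conn0 min0] F0F] := minset_exists connF.
exists F0; rewrite ?conn0 //=; apply/asboolP => -[|x [|y [|z c]]] // _ Uc.
apply/negP => cyc; have conn1 := connected_setD1_cycle conn0 Uc cyc.
have := min0 _ conn1 (subsetDl _ _); move: cyc => /= /andP[Fxy _].
by move/setP/(_ [set x; y]%SET); rewrite in_setD1 -adjE Fxy eqxx.
Qed.

End Connectivity.

Section TreeWeight.
Variables (R : realType) (V : finType) (K : weighted_graph R V).
Implicit Types F : {set {set V}}.

Lemma max_tree_weight_ge0 : 0 <= max_tree_weight K.
Proof. exact: bigmax_ge_id. Qed.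

Lemma max_tree_weight_attained : max_tree_weight K = 0 \/
  exists2 F : {set {set V}}, F \in spanning_trees (edges K) &
    \prod_(e in F) weight K e = max_tree_weight K.
Proof.
rewrite /max_tree_weight; elim/big_ind: _ => [|x y hx hy|F sF]; first by left.
  by rewrite /Order.max; case: ifP.
by right; exists F.
Qed.

Lemma prod_weight_itv F : F \subset edges K -> 0 <= \prod_(e in F) weight K e <= 1.
Proof.
move=> /subsetP FK; rewrite prodr_ge0 ?prodr_ile1 // => e /FK /weight_itv // /andP[] //.
Qed.

(** The edges left out by a spanning tree of F have weight at most 1. *)
Lemma prod_le_max_tree_weight F : F \subset edges K -> connected_edges F ->
  \prod_(e in F) weight K e <= max_tree_weight K.
Proof.
move=> FK /exists_spanning_tree[F0 F0F treeF0].
have F0K := subset_trans F0F FK.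
apply: (@le_trans _ _ (\prod_(e in F0) weight K e)); last first.
  by apply: le_bigmax_cond; rewrite inE F0K.
rewrite (big_setID F0) /= (setIidPr F0F); apply: ler_piMr.
  by case/andP: (prod_weight_itv F0K).
by case/andP: (prod_weight_itv (subset_trans (subsetDl F F0) FK)).
Qed.

(** Connect each block C of pi by the edges E C and add the edges E1 of weight one.
The set of vertices reached from a given v is a union of blocks of pi and of
components of E1, so it is everything by indecomposability. *)
Lemma prod_le_max_tree_weight_glue (E1 : {set {set V}}) (pi : {set {set V}})
    (E : {set V} -> {set {set V}}) :
  E1 \subset edges K -> (forall e, e \in E1 -> weight K e = 1) ->
  partition pi [set: V]%SET -> indecomposable (components E1) pi ->
  (forall C, C \in pi -> E C \subset edges K) ->
  (forall C e, C \in pi -> e \in E C -> e \subset C) ->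
  (forall C, C \in pi -> {in C &, forall x y, connect (adj (E C)) x y}) ->
  \prod_(C in pi) \prod_(e in E C) weight K e <= max_tree_weight K.
Proof.
move=> E1K w1 pT ind EK EC conn; have tpi := partition_trivIset pT.
(* E is only controlled on the blocks of pi, while the lemma on disjoint unions
   used below ranges over all sets C. *)
pose E' C := [set e in E C | C \in pi]%SET.
pose F' := (\bigcup_C E' C)%SET; pose F := E1 :|: F'.
have EF' C : C \in pi -> E C \subset F'.
  move=> Cpi; apply: subset_trans (bigcup_sup C _) => //.
  by apply/subsetP => e eC; rewrite inE eC.
have F'K : F' \subset edges K.
  apply/bigcupsP => C _; apply/subsetP => e /setIdP[eC Cpi].
  exact: subsetP (EK C Cpi) _ eC.
have FK : F \subset edges K by rewrite subUset E1K.
have compE1 := components_partition E1.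
have connF : connected_edges F.
  apply/connected_edgesP => v u; pose W := [set u | connect (adj F) v u]%SET.
  pose rho := [set B in components E1 | B \subset W].
  have coverrho : cover rho = W.
    apply/setP => y; apply/bigcupP/idP => [[B /setIdP[_ /subsetP]]|yW]; first by apply.
    have yc : y \in cover (components E1) by rewrite (cover_partition compE1) inE.
    exists (pblock (components E1) y); last by rewrite mem_pblock.
    rewrite inE pblock_mem //=; apply/subsetP => z zB.
    have yz := mem_components (pblock_mem yc) (_ : y \in _) zB; rewrite mem_pblock in yz.
    move: yW; rewrite !inE => vy; apply: connect_trans vy _.
    exact: connect_adjS (subsetUl _ _) _ _ (yz yc).
  have : rho = components E1.
    apply: (indecomposableP _ _ ind); first by apply/subsetP => B /setIdP[].
      apply/eqP => rho0; have := coverrho; rewrite rho0 /cover big_set0.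
      by move/setP/(_ v); rewrite !inE connect0.
    rewrite coverrho; apply/saturatedP => y yW.
    have yc : y \in cover pi by rewrite (cover_partition pT) inE.
    exists (pblock pi y); rewrite pblock_mem // mem_pblock; split=> //.
    apply/subsetP => z zC; move: yW; rewrite !inE => vy; apply: connect_trans vy _.
    apply: (@connect_adjS _ (E (pblock pi y))); last first.
      by apply: conn; rewrite ?pblock_mem ?mem_pblock.
    by apply: subset_trans (subsetUr _ _); apply: EF'; apply: pblock_mem.
  move=> rhoE; have : u \in W by rewrite -coverrho rhoE (cover_partition compE1) inE.
  by rewrite inE.
apply: le_trans (prod_le_max_tree_weight FK connF).
have -> : \prod_(e in F) weight K e = \prod_(e in F') weight K e.
  rewrite (big_setID E1) [RHS](big_setID E1) /=.
  rewrite [X in X * _ = _]big1 => [|e /setIP[_ /w1]] //.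
  rewrite [X in _ = X * _]big1 => [|e /setIP[_ /w1]] //.
  by congr (_ * _); apply: eq_bigl => e; rewrite !inE; case: (e \in E1).
rewrite partition_disjoint_bigcup => [|C C' CC'].
  rewrite big_mkcond /= le_eqVlt; apply/orP; left; apply/eqP/eq_bigr => C _.
  case: ifP => Cpi; last by rewrite big1 // => e; rewrite inE Cpi andbF.
  by apply: eq_bigl => e; rewrite inE Cpi andbT.
rewrite disjoint_subset; apply/subsetP => e /setIdP[eC Cpi]; rewrite !inE.
apply/negP => /andP[eC' Cpi']; case/negP: CC'; apply/eqP.
have /card_gt0P[x xe] : (0 < #|e|)%N by rewrite (card_edge (subsetP (EK C Cpi) _ eC)).
apply: (trivIset_eq tpi Cpi Cpi' (subsetP (EC _ _ Cpi eC) _ xe)).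
exact: subsetP (EC _ _ Cpi' eC') _ xe.
Qed.

End TreeWeight.


(** * Restriction to a block of copies *)

(** The induction hypothesis speaks of the copies of the multiset of tags of a
block C of [copies B].  These copies embed into [copies B] with image C, and
cumulants and tree weights are transported along such an embedding. *)

Section Transport.
Variables (V' V : finType) (f : V' -> V).
Hypothesis f_inj : injective f.

Lemma cumulant_of_imset (R : comNzRingType) (m : {set V} -> R) (S : {set V'}) :
  cumulant_of m (f @: S) = cumulant_of (fun C : {set V'} => m (f @: C)) S.
Proof.
pose im (C : {set V'}) := f @: C; pose pim (C : {set V}) := f @^-1: C.
have im_inj : injective im by exact: imset_inj.
have imK : cancel im pim.
  by move=> C; apply/setP => x; rewrite inE mem_imset.
rewrite /cumulant_of (reindex_onto (fun pi : {set {set V'}} => im @: pi)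
    (fun pi : {set {set V}} => pim @: pi)) /=; last first.
  move=> pi pS; rewrite -imset_comp -[RHS]imset_id; apply: eq_in_imset => C Cpi /=.
  apply/setP => x; apply/imsetP/idP => [[y]|xC]; first by rewrite inE => yC ->.
  have /imsetP[y _ xy] := subsetP (partitionS pS Cpi) _ xC.
  by exists y; rewrite // inE -xy.
apply: eq_big => [pi|pi _].
  rewrite imset_partition // -imset_comp (eq_imset (g := id)) => [|C]; last exact: imK.
  by rewrite imset_id eqxx andbT.
rewrite card_imset // big_imset //=; exact: in2W.
Qed.

Lemma imset_spanning_tree (R : realType) (K' : weighted_graph R V')
    (K : weighted_graph R V) :
  (forall e, e \in edges K' -> f @: e \in edges K /\ weight K (f @: e) = weight K' e) ->
  max_tree_weight K' != 0 ->
  exists E : {set {set V}}, [/\ E \subset edges K,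
    forall e, e \in E -> e \subset f @: [set: V']%SET,
    {in f @: [set: V']%SET &, forall x y, connect (adj E) x y} &
    \prod_(e in E) weight K e = max_tree_weight K'].
Proof.
move=> fE; have [->|[F]] := max_tree_weight_attained K'; first by rewrite eqxx.
rewrite inE => /and3P[/subsetP FK /connected_edgesP connF _] Fw _.
exists [set f @: (e : {set V'}) | e in F]%SET; split.
- by apply/subsetP => _ /imsetP[e eF ->]; case: (fE e (FK e eF)).
- by move=> _ /imsetP[e eF ->]; apply: imsetS; apply: subsetT.
- move=> _ _ /imsetP[u _ ->] /imsetP[v _ ->].
  case/connectP: (connF u v) => p pp ->; apply/connectP.
  exists (map f p); last by rewrite last_map.
  rewrite path_map; apply: sub_path pp => a b; rewrite /= !adjE => abF.
  by apply/imsetP; exists [set a; b]%SET; rewrite // imsetU1 imset_set1.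
rewrite big_imset /= => [|e e' _ _]; last exact: imset_inj.
by rewrite -Fw; apply: eq_bigr => e eF; case: (fE e (FK e eF)).
Qed.

End Transport.

Section TagMultiset.
Variables (A : finType) (B : {mset A}).
Implicit Types (C S U : {set copies B}) (a : A).

(** The multiset of elements of A whose copies make up C. *)
Definition tags C : {mset A} := seq_mset [seq tag v | v <- enum C].

Lemma tagsE C a : tags C a = #|[set v in C | tag v == a]%SET|.
Proof.
rewrite mset_seqE count_map cardsE -sum1_card -sum1_count big_enum_cond /=.
exact: eq_bigl.
Qed.

Lemma size_tags C : size (tags C) = #|C|.
Proof. by rewrite (perm_size (perm_eq_seq_mset _)) size_map cardE. Qed.

Lemma tags_setT : tags [set: copies B]%SET = B.
Proof.
apply/msetP => a; rewrite tagsE.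
rewrite -[RHS]card_ord.
rewrite -(card_imset (f := fun i : 'I_(B a) => Tagged (fun a => 'I_(B a)) i)) //.
  apply: eq_card => -[a' i]; rewrite !inE /=.
  apply/eqP/imsetP => [aa|[j _ /(congr1 tag)]//].
  by case: _ / aa in i *; exists i.
by move=> i j /eqP; rewrite eq_Tagged => /eqP.
Qed.

Lemma tags_set0 : tags set0 = mset0.
Proof. by apply/msetP => a; rewrite tagsE mset0E; apply: eq_card0 => v; rewrite !inE. Qed.

Lemma tags_setU S U : [disjoint S & U] -> tags (S :|: U) = tags S `+` tags U.
Proof.
move=> dSU; apply/msetP => a; rewrite msetE2 !tagsE.
rewrite -cardsUI [X in (_ + X)%N]eq_card0 ?addn0.
  by apply: eq_card => v; rewrite !inE andb_orl.
move=> v; rewrite !inE; case: (boolP (v \in S)) => //= vS.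
by rewrite (disjointFr dSU vS) andbF.
Qed.

Lemma tags_neq0 C : C != set0 -> tags C != mset0.
Proof.
by apply: contraNneq => C0; rewrite -cards_eq0 -size_tags C0 enum_mset0.
Qed.

(** Super-multiplicativity only speaks of two nonempty multisets: add the blocks
one at a time, starting from a single block. *)
Lemma super_multiplicative_partition (R : realType) (Psi : {mset A} -> R)
    (pi : {set {set copies B}}) :
  (forall B, B != mset0 -> 0 <= Psi B) -> super_multiplicative Psi ->
  pi != set0 -> trivIset pi -> set0 \notin pi ->
  \prod_(C in pi) Psi (tags C) <= Psi (tags (cover pi)).
Proof.
move=> Psi0 superPsi; have [n] := ubnP #|pi|; elim: n pi => // n IH pi pin pi0 tpi npi.
have /set0Pn[C Cpi] := pi0.
have neC : C != set0 by apply: contraNneq npi => <-.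
rewrite (big_setD1 C) //=; have [pi1|pi1] := eqVneq (pi :\ C) set0.
  by rewrite pi1 big_set0 mulr1 -(setD1K Cpi) pi1 setU0 cover1.
have tpi1 := trivIsetD [set C] tpi.
have npi1 : set0 \notin pi :\ C by rewrite !inE (negbTE npi) andbF.
have le1 := IH _ (_ : #|pi :\ C| < n)%N pi1 tpi1 npi1.
have cov : cover pi = C :|: cover (pi :\ C).
  rewrite coverD1 //; apply/setP => x; rewrite !inE; case: (boolP (x \in C)) => //= xC.
  by apply/bigcupP; exists C.
have dC : [disjoint C & cover (pi :\ C)].
  rewrite coverD1 // disjoint_subset; apply/subsetP => x xC; by rewrite !inE xC.
rewrite cov tags_setU //; apply: le_trans (superPsi _ _ (tags_neq0 neC) _).
  apply: ler_wpM2l; first exact: Psi0 (tags_neq0 neC).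
  apply: le1; move: pin; by rewrite (cardsD1 C) Cpi ltnS.
apply: tags_neq0; have /set0Pn[C' C'pi] := pi1.
apply: contraNneq npi1 => c0; suff <- : C' = set0 by [].
by apply/eqP; rewrite -subset0 -c0; apply: bigcup_max C'pi _.
Qed.

End TagMultiset.

(** For each a, number the elements of C tagged by a. *)
Lemma copies_tags (A : finType) (B : {mset A}) (C : {set copies B}) :
  exists f : copies (tags C) -> copies B,
  [/\ injective f, forall u, tag (f u) = tag u & f @: [set: copies (tags C)]%SET = C].
Proof.
pose f (u : copies (tags C)) : copies B :=
  enum_val (cast_ord (tagsE C (tag u)) (tagged u)).
have fC u : f u \in [set v in C | tag v == tag u]%SET by apply: enum_valP.
have ftag u : tag (f u) = tag u by have := fC u; rewrite inE => /andP[_ /eqP].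
have finj : injective f.
  move=> [a i] [b j] e; have ab : a = b by have := congr1 (@tag _ _) e; rewrite !ftag.
  case: _ / ab in j e *; have := enum_val_inj e => /cast_ord_inj /= -> //.
exists f; split => //; apply/eqP; rewrite eqEcard; apply/andP; split.
  by apply/subsetP => _ /imsetP[u _ ->]; have := fC u; rewrite inE => /andP[].
rewrite card_imset // -(size_tags [set: copies (tags C)]%SET) tags_setT.
by rewrite size_tags leqnn.
Qed.



(** * The bound *)

Section Constants.
Variables (R : realType) (D : nat -> R).
Hypothesis D_gt0 : forall r, (0 < r)%N -> 0 < D r.

(** On r.+1 points there are at most 2 ^ 2 ^ r.+1 partitions, each with at most
r.+1 blocks; in the partitions other than the trivial one the blocks have at
most r points.  The summand [cumulant_bound r] makes the sequence nondecreasing,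
so that one constant serves for all those blocks. *)
Fixpoint cumulant_bound (n : nat) : R :=
  if n is r.+1 then
    cumulant_bound r + (D r.+1 + (2 ^ 2 ^ r.+1)%:R * cumulant_bound r ^+ r.+1)
  else 1.

Lemma cumulant_bound_ge1 n : 1 <= cumulant_bound n.
Proof.
elim: n => //= n IH; apply: (le_trans IH); rewrite lerDl.
apply: addr_ge0; first exact/ltW/D_gt0.
by rewrite mulr_ge0 ?ler0n // exprn_ge0 // (le_trans ler01).
Qed.

Lemma cumulant_bound_mono m n : (m <= n)%N -> cumulant_bound m <= cumulant_bound n.
Proof.
elim: n => [|n IH]; first by rewrite leqn0 => /eqP->.
rewrite leq_eqVlt => /orP[/eqP->//|/IH mn]; apply: le_trans mn _ => /=.
rewrite lerDl; apply: addr_ge0; first exact/ltW/D_gt0.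
by rewrite mulr_ge0 ?ler0n // exprn_ge0 // (le_trans ler01) ?cumulant_bound_ge1.
Qed.

Lemma cumulant_bound_step n :
  D n.+1 + (2 ^ 2 ^ n.+1)%:R * cumulant_bound n ^+ n.+1 <= cumulant_bound n.+1.
Proof. by rewrite /= lerDr (le_trans ler01) ?cumulant_bound_ge1. Qed.

End Constants.

Section InducedGraph.
Variables (R : realType) (A : finType) (L : weighted_graph R A) (B : {mset A}).

Lemma induced_weight1_subset :
  edges (induced_graph (weight1_subgraph L) B) \subset edges (induced_graph L B).
Proof.
apply/subsetP => e; rewrite !inE => /andP[-> /orP[->//|]].
by move=> /andP[-> _]; rewrite orbT.
Qed.

Lemma induced_weight1 e : e \in edges (induced_graph (weight1_subgraph L) B) ->
  weight (induced_graph L B) e = 1.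
Proof.
rewrite !inE => /andP[_ h]; rewrite /= /induced_weight; case: ifP h => //= _.
by case/andP=> _ /eqP.
Qed.

Lemma induced_spanning_tree (C : {set copies B}) :
  max_tree_weight (induced_graph L (tags C)) != 0 ->
  exists E : {set {set copies B}}, [/\ E \subset edges (induced_graph L B),
    forall e, e \in E -> e \subset C,
    {in C &, forall x y, connect (adj E) x y} &
    \prod_(e in E) weight (induced_graph L B) e =
      max_tree_weight (induced_graph L (tags C))].
Proof.
have [f [finj ftag fC]] := copies_tags C.
have := @imset_spanning_tree _ _ _ finj _ (induced_graph L (tags C)) (induced_graph L B).
rewrite fC; apply=> e.
have te : tag @: (f @: e) = tag @: e.
  by rewrite -imset_comp; apply: eq_imset => u; apply: ftag.
by rewrite !inE /= /induced_weight te (card_imset _ finj).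
Qed.

(** When some block has tree weight 0 there may be no spanning tree to choose in
it, but then the product vanishes. *)
Lemma prod_max_tree_weight_le (pi : {set {set copies B}}) :
  partition pi [set: copies B]%SET ->
  indecomposable (components (edges (induced_graph (weight1_subgraph L) B))) pi ->
  \prod_(C in pi) max_tree_weight (induced_graph L (tags C))
    <= max_tree_weight (induced_graph L B).
Proof.
move=> pT ind.
case: (boolP [exists C in pi, max_tree_weight (induced_graph L (tags C)) == 0]).
  case/exists_inP => C Cpi /eqP C0.
  by rewrite (big_setD1 C) //= C0 mul0r max_tree_weight_ge0.
rewrite negb_exists_in => /forall_inP nz.
have /choice[E HE] : forall C : {set copies B}, exists E : {set {set copies B}},
    C \in pi -> [/\ E \subset edges (induced_graph L B),
      forall e, e \in E -> e \subset C,
      {in C &, forall x y, connect (adj E) x y} &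
      \prod_(e in E) weight (induced_graph L B) e =
        max_tree_weight (induced_graph L (tags C))].
  move=> C; case: (boolP (C \in pi)) => [/nz/induced_spanning_tree[E HE]|].
    by exists E.
  by exists set0.
have prodE C : C \in pi -> \prod_(e in E C) weight (induced_graph L B) e =
    max_tree_weight (induced_graph L (tags C)) by case/HE.
rewrite -(eq_bigr _ prodE).
apply: prod_le_max_tree_weight_glue induced_weight1_subset induced_weight1 pT ind _ _ _.
- by move=> C /HE[].
- by move=> C e /HE[_ h _ _]; apply: h.
- by move=> C /HE[].
Qed.

End InducedGraph.

Section JointMoments.
Variables (R : realType) (d : measure_display) (T : measurableType d).
Variable P : probability T R.
Variables (A : finType) (Y : A -> T -> R).

Definition joint_moment (B : {mset A}) (C : {set copies B}) : R :=
  fine 'E_P[fun w => \prod_(v in C) Y (tag v) w].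

Lemma joint_moment0 B : joint_moment (set0 : {set copies B}) = 1.
Proof.
rewrite /joint_moment (_ : (fun w => _) = cst 1); first by rewrite expectation_cst.
by apply/funext => w; rewrite big_set0.
Qed.

Lemma cumulant_tags (B : {mset A}) (C : {set copies B}) :
  cumulant P [set: copies (tags C)]%SET (fun v => Y (tag v)) =
  cumulant_of (@joint_moment B) C.
Proof.
have [f [finj ftag fC]] := copies_tags C.
rewrite -[in RHS]fC cumulant_of_imset //; apply: eq_bigr => pi _; congr (_ * _).
apply: eq_bigr => S _; rewrite /joint_moment; congr (fine 'E_P[ _ ]).
apply/funext => w; rewrite big_imset /=; last exact: in2W.
by apply: eq_bigr => u _; rewrite ftag.
Qed.

Lemma cumulant_products (B : {mset A}) (tau : {set {set copies B}}) : trivIset tau ->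
  cumulant P tau (fun S w => \prod_(v in S) Y (tag v) w) =
  cumulant_of (fun rho : {set {set copies B}} => joint_moment (cover rho)) tau.
Proof.
move=> ttau; apply: eq_bigr => pi pS; congr (_ * _).
apply: eq_bigr => rho rhopi; congr (fine 'E_P[ _ ]).
apply/funext => w; rewrite big_trivIset //.
exact: trivIsetS (partitionS pS rhopi) ttau.
Qed.

End JointMoments.

Theorem proposition5p2 (R : realType) (D : nat -> R)
    (D_gt0 : forall r, (0 < r)%N -> 0 < D r) :
  exists C : nat -> R,
    (forall r, (0 < r)%N -> 0 < C r) /\
    forall (d : measure_display) (T : measurableType d) (P : probability T R)
      (A : finType) (Y : A -> {RV P >-> R}) (L : weighted_graph R A)
      (Psi : {mset A} -> R),
      (forall a : A, finite_moments P (Y a)) ->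
      (forall B : {mset A}, B != mset0 -> 0 <= Psi B) ->
      super_multiplicative Psi ->
      (forall B : {mset A}, B != mset0 ->
        `|cumulant P (components (edges (induced_graph (weight1_subgraph L) B)))
            (fun (S : {set copies B}) (w : T) => \prod_(v in S) Y (tag v) w)|
          <= D (size B) * Psi B * max_tree_weight (induced_graph L B)) ->
      weighted_dependency_graph P (fun a => Y a : T -> R) L Psi C.
Proof.
exists (cumulant_bound D); split=> [r _|d T P A Y L Psi _ Psi0 superPsi bound].
  by rewrite (lt_le_trans ltr01) ?cumulant_bound_ge1.
move=> B; have [n] := ubnP (size B); elim: n B => // n IH B sB B0.
pose V : {set copies B} := [set: copies B]%SET.
have cardV : #|V| = size B by rewrite -size_tags tags_setT.
have V0 : V != set0.
  by apply: contraNneq B0 => V0; have := tags_setT B; rewrite -/V V0 tags_set0 => <-.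
pose m := @joint_moment R d T P A (fun a => Y a : T -> R) B.
have m0 : m set0 = 1 by apply: joint_moment0.
pose M := max_tree_weight (induced_graph L B).
have M0 : 0 <= M by apply: max_tree_weight_ge0.
have PsiB0 := Psi0 B B0.
pose tau := components (edges (induced_graph (weight1_subgraph L) B)).
have tauV : partition tau V by apply: components_partition.
have ttau := partition_trivIset tauV.
have tau0 : tau != set0.
  by apply: contraNneq V0 => tau0; rewrite -(cover_partition tauV) tau0 /cover big_set0.
have {}bound : `|cumulant_of (fun rho : {set {set copies B}} => m (cover rho)) tau|
    <= D (size B) * Psi B * M by rewrite -cumulant_products //; apply: bound.
have [r sizeB] : exists r, size B = r.+1.
  by rewrite -cardV; exists #|V|.-1; rewrite prednK ?card_gt0.
pose c := cumulant_bound D r.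
have c1 : 1 <= c by apply: cumulant_bound_ge1.
have c0 : 0 <= c := le_trans ler01 c1.
(* The terms of the Leonov-Shiryaev formula with at least two blocks. *)
have term pi : partition pi V && indecomposable tau pi && (pi != [set V]) ->
    `|\prod_(C in pi) cumulant_of m C| <= c ^+ r.+1 * (Psi B * M).
  case/andP=> /andP[piV ind] pi1; rewrite normr_prod.
  have neC C : C \in pi -> tags C != mset0 by move=> /(partition_neq0 piV)/tags_neq0.
  apply: (@le_trans _ _ (\prod_(C in pi)
      (c * (Psi (tags C) * max_tree_weight (induced_graph L (tags C)))))).
    apply: ler_prod => C Cpi; rewrite normr_ge0 /= -cumulant_tags.
    have ltC := card_block_lt piV pi1 Cpi.
    rewrite cardV sizeB in ltC.
    apply: le_trans (IH (tags C) _ (neC C Cpi)) _.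
      by rewrite size_tags (leq_trans ltC) // -ltnS -sizeB.
    rewrite -mulrA; apply: ler_wpM2r.
      by rewrite mulr_ge0 ?max_tree_weight_ge0 ?Psi0 ?neC.
    by apply: cumulant_bound_mono => //; rewrite size_tags -ltnS.
  rewrite !big_split /= prodr_const; apply: ler_pM.
  - by rewrite exprn_ge0.
  - by rewrite mulr_ge0 // prodr_ge0 // => C Cpi; rewrite ?max_tree_weight_ge0 ?Psi0 ?neC.
  - by apply: ler_weXn2l => //; rewrite -sizeB -cardV card_partition_le.
  apply: ler_pM.
  - by rewrite prodr_ge0 // => C Cpi; rewrite Psi0 ?neC.
  - by rewrite prodr_ge0 // => C Cpi; rewrite max_tree_weight_ge0.
  - rewrite -[X in Psi X](tags_setT B) -/V -(cover_partition piV).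
    apply: super_multiplicative_partition => //.
    + by rewrite -card_gt0 (partition_neq0_card V0 piV).
    + exact: partition_trivIset piV.
    + by rewrite (partition0 piV).
  exact: prod_max_tree_weight_le.
have LS := leonov_shiryaev m0 ttau tau0.
rewrite /indecomposable_sum (cover_partition tauV) (bigD1 [set V]) /= in LS; last first.
  by rewrite partition_set1 // indecomposable_set1.
rewrite big_set1 in LS.
(* Solve the Leonov-Shiryaev formula for its term with the one-block partition. *)
have -> : cumulant P V (fun v => Y (tag v)) = cumulant_of m V by [].
rewrite -[cumulant_of m V](addrK (\sum_(pi | partition pi V && indecomposable tau pi
  && (pi != [set V])) \prod_(C in pi) cumulant_of m C)) -LS.
apply: le_trans (ler_normB _ _) _.
have PsiM0 : 0 <= Psi B * M by rewrite mulr_ge0.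
rewrite sizeB -[_ * Psi B * _]mulrA.
apply: le_trans (ler_wpM2r PsiM0 (cumulant_bound_step D_gt0 r)).
rewrite mulrDl; apply: lerD; first by rewrite mulrA -sizeB.
apply: le_trans (ler_norm_sum _ _ _) _; apply: le_trans (ler_sum _ term) _.
rewrite sumr_const -[leLHS]mulr_natl -[leRHS]mulrA; apply: ler_wpM2r.
  by rewrite !mulr_ge0 ?exprn_ge0.
rewrite ler_nat (leq_trans (max_card _)) //.
rewrite -cardsT -powersetT card_powerset -powersetT card_powerset.
by rewrite -sizeB -cardV.
Qed.
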